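(* Let $(X,d)$ be a compact metric space, $\boldsymbol f=\{f_i\}_{i=1}^\infty$ a sequence of continuous self-maps of $X$ and $\varphi\in C(X,\mathbb R)$. For any nonempty $Z\subseteq X$ and $0<\theta<\phi\le1$, we have $$\overline P(\boldsymbol f,Z,\varphi,\theta)\le\overline P(\boldsymbol f,Z,\varphi,\phi)\le\frac{\phi}{\theta}\,\overline P(\boldsymbol f,Z,\varphi,\theta)+\Bigl(\frac{\phi}{\theta}-1\Bigr)\|\varphi\|,$$ $$\underline P(\boldsymbol f,Z,\varphi,\theta)\le\underline P(\boldsymbol f,Z,\varphi,\phi)\le\frac{\phi}{\theta}\,\underline P(\boldsymbol f,Z,\varphi,\theta)+\Bigl(\frac{\phi}{\theta}-1\Bigr)\|\varphi\|,$$ where $\underline P,\overline P$ are the lower and upper intermediate topological pressures. In particular, when $\varphi\equiv0$, writing $\underline h_{\mathrm{top}}(\boldsymbol f,Z,\theta)=\underline P(\boldsymbol f,Z,0,\theta)$ and $\overline h_{\mathrm{top}}(\boldsymbol f,Z,\theta)=\overline P(\boldsymbol f,Z,0,\theta)$, $$\overline h_{\mathrm{top}}(\boldsymbol f,Z,\theta)\le\overline h_{\mathrm{top}}(\boldsymbol f,Z,\phi)\le\frac{\phi}{\theta}\,\overline h_{\mathrm{top}}(\boldsymbol f,Z,\theta),\qquad \underline h_{\mathrm{top}}(\boldsymbol f,Z,\theta)\le\underline h_{\mathrm{top}}(\boldsymbol f,Z,\phi)\le\frac{\phi}{\theta}\,\underline h_{\mathrm{top}}(\boldsymbol f,Z,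\theta).$$
   Context: Pressures take values in $[-\infty,+\infty]$. $C(X,\mathbb R)$ is the space of continuous real functions on $X$ with the supremum norm $\|\cdot\|$. Put $f_1^0=\mathrm{id}_X$, $f_1^n=f_n\circ\cdots\circ f_1$ for $n\ge1$, and $S_n\varphi(x)=\sum_{j=0}^{n-1}\varphi(f_1^j x)$. For a finite open cover $\mathcal U$ of $X$, $\mathcal S_m(\mathcal U)$ is the set of strings $\mathbf U=(U_0,\dots,U_{m-1})$ with all $U_j\in\mathcal U$; $m(\mathbf U)=m$ is the length of $\mathbf U$; and $X(\mathbf U)=\{x\in X: f_1^j(x)\in U_j,\ 0\le j\le m-1\}$. For $Z\subseteq X$, $\alpha\in\mathbb R$, $N\in\mathbb N$, $\theta\in[0,1]$ let $$M(Z,\alpha,\varphi,\mathcal U,N,\theta)=\inf_{\mathcal G}\sum_{\mathbf U\in\mathcal G}\exp\Bigl(-\alpha m(\mathbf U)+\sup_{x\in X(\mathbf U)}S_{m(\mathbf U)}\varphi(x)\Bigr),$$ the infimum over all finite or countable collections $\mathcal G$ of strings of lengths $m$ with $N\le m<N/\theta+1$ (for $\theta=0$: $m\ge N$) such that $Z\subseteq\bigcup_{\mathbf U\in\mathcal G}X(\mathbf U)$; the supremum over an empty $X(\mathbf U)$ is $-\infty$ (so the term is $0$). Let $\underline m$ and $\overline m$ be the $\liminf$ and $\limsup$ of $M(Z,\alpha,\varphi,\mathcal U,N,\theta)$ as $N\to\infty$, and $$\underline P(\boldsymbol f,Z,\varphi,\mathcal U,\theta)=\inf\{\alpha:\underline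 m=0\}=\sup\{\alpha:\underline m=\infty\},\quad \overline P(\boldsymbol f,Z,\varphi,\mathcal U,\theta)=\inf\{\alpha:\overline m=0\}=\sup\{\alpha:\overline m=\infty\}.$$ With $|\mathcal U|=\max_{U\in\mathcal U}\operatorname{diam}U$, the lower and upper $\theta$-intermediate topological pressures are $\underline P(\boldsymbol f,Z,\varphi,\theta)=\lim_{|\mathcal U|\to0}\underline P(\boldsymbol f,Z,\varphi,\mathcal U,\theta)$ and $\overline P(\boldsymbol f,Z,\varphi,\theta)=\lim_{|\mathcal U|\to0}\overline P(\boldsymbol f,Z,\varphi,\mathcal U,\theta)$ (these limits exist). *)

(* Defs.v *)
From HB Require Import structures.
From mathcomp Require Import all_boot all_order all_algebra.
From mathcomp Require Import all_classical all_reals all_analysis.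

Set Implicit Arguments.
Unset Strict Implicit.
Unset Printing Implicit Defensive.

Import Order.TTheory GRing.Theory Num.Theory.
Import numFieldNormedType.Exports.

Local Open Scope classical_set_scope.
Local Open Scope ring_scope.

Section Pressure.
Context {R : realType} {X : metricType R}.
Implicit Types (f : nat -> X -> X) (phi : X -> R) (Z : set X)
  (cU : set (set X)) (s : seq (set X)) (theta alpha : R).

(* The sequence of maps is indexed from 1; the value [f 0] is never used. *)
Fixpoint comp1 f (n : nat) : X -> X :=
  if n is k.+1 then f k.+1 \o comp1 f k else id.

Definition birkhoff_sum f phi (n : nat) (x : X) : R :=
  \sum_(j < n) phi (comp1 f j x).

(* [X] is meant to be compact and nonempty, so that the real-valued suprema in
   [sup_norm], [diam] and [mesh] are taken over bounded sets, and the one in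
   [mesh] is a maximum over a finite nonempty family; [diam set0 = 0]. *)
Definition sup_norm phi : R := sup [set `|phi x| | x in [set: X]].

Definition diam (A : set X) : R := sup [set mdist x y | x in A & y in A].

Definition mesh cU : R := sup [set diam U | U in cU].

Definition finite_open_cover cU : Prop :=
  [/\ finite_set cU, (forall U, cU U -> open U)
    & [set: X] `<=` \bigcup_(U in cU) U].

Definition is_string cU s : Prop := forall U, U \in s -> cU U.

Definition string_set f s : set X :=
  [set x | forall j, (j < size s)%N -> nth set0 s j (comp1 f j x)].

Definition admissible_length theta (N m : nat) : Prop :=
  (N <= m)%N /\ (theta = 0 \/ m%:R < N%:R / theta + 1).

Definition admissible f Z cU (N : nat) theta (G : set (seq (set X))) : Prop :=
  [/\ countable G,
      (forall s, G s -> is_string cU s /\ admissible_length theta N (size s))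
    & Z `<=` \bigcup_(s in G) string_set f s].

(* [ereal_sup set0 = -oo] and [expeR -oo = 0]: the weight vanishes when
   [string_set f s] is empty. *)
Definition string_weight f phi alpha s : \bar R :=
  expeR ((- (alpha * (size s)%:R))%:E
         + ereal_sup [set (birkhoff_sum f phi (size s) x)%:E
                     | x in string_set f s])%E.

Definition M f Z alpha phi cU (N : nat) theta : \bar R :=
  ereal_inf [set \esum_(s in G) string_weight f phi alpha s
            | G in admissible f Z cU N theta].

Definition lower_m f Z alpha phi cU theta : \bar R :=
  limn_einf (fun N => M f Z alpha phi cU N theta).

Definition upper_m f Z alpha phi cU theta : \bar R :=
  limn_esup (fun N => M f Z alpha phi cU N theta).

Definition lower_pressure_cover f Z phi cU theta : \bar R :=
  ereal_inf [set alpha%:E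
            | alpha in [set a : R | lower_m f Z a phi cU theta = 0%E]].

Definition upper_pressure_cover f Z phi cU theta : \bar R :=
  ereal_inf [set alpha%:E
            | alpha in [set a : R | upper_m f Z a phi cU theta = 0%E]].

(* The filter of finite open covers [cU] with [mesh cU] tending to 0. *)
Definition fine_covers : set_system (set (set X)) :=
  filter_from [set e : R | 0 < e]
    (fun e => [set cU | finite_open_cover cU /\ mesh cU < e]).

Definition lower_pressure f Z phi theta : \bar R :=
  lim (lower_pressure_cover f Z phi cU theta @[cU --> fine_covers]).

Definition upper_pressure f Z phi theta : \bar R :=
  lim (upper_pressure_cover f Z phi cU theta @[cU --> fine_covers]).

Definition lower_entropy f Z theta : \bar R := lower_pressure f Z (cst 0) theta.

Definition upper_entropy f Z theta : \bar R := upper_pressure f Z (cst 0) theta.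

End Pressure.

(* Main.v *)
(* Monotonicity in theta holds because a larger theta allows fewer strings.  For
   the second bound, fix a fine cover U on whose members varphi oscillates by at
   most g, and let K be the norm of varphi.  In a family of strings of lengths
   n < N/theta + 1, truncate those longer than m = ceil(N/phi) to length m.
   Truncation enlarges X(U), which changes the supremum of the Birkhoff sum by at
   most m g + (n - m) K, so the total weight at exponent a' stays below the one at
   exponent a as soon as a' > (n/m)(a + K) - K + g.  Since a >= -K for every
   exponent a with vanishing limit and n/m is at most phi/theta + o(1), this holds
   for a' = (phi/theta) a + (phi/theta - 1) K + g + e and N large.  Comparing a
   cover with refinements of it (Lebesgue number) in the same way shows that the
   pressures of covers form a Cauchy-like family in [-oo, +oo], so that the limit
   over covers is a lower limit, through which the bound passes as g -> 0. *)
Require Import Defs.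
From HB Require Import structures.
From mathcomp Require Import all_boot all_order all_algebra.
From mathcomp Require Import all_classical all_reals all_analysis.
From mathcomp Require Import ring lra.

Set Implicit Arguments.
Unset Strict Implicit.
Unset Printing Implicit Defensive.

Import Order.TTheory GRing.Theory Num.Theory.
Import numFieldNormedType.Exports.

Local Open Scope classical_set_scope.
Local Open Scope ring_scope.

(** * Lower limits along a filter, with values in [-oo, +oo] *)

Section LowerLimit.
Context {R : realType} {T : Type} (F : set_system T) {FF : ProperFilter F}.
Implicit Types p q : T -> \bar R.
Local Open Scope ereal_scope.

(** Always defined, so eventual inequalities pass to it before any convergence is known; [pressureE]
    later identifies it with the limit over covers. *)
Definition lower_limit p : \bar R := ereal_sup [set a | \forall t \near F, a <= p t].

Lemma lower_limit_le p q :
  (\forall t \near F, p t <= q t) -> lower_limit p <= lower_limit q.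
Proof.
move=> pq; apply: ge_ereal_sup => a /= ap; apply: ereal_sup_ubound => /=.
by apply: filterS2 pq ap => t pqt /le_trans; apply.
Qed.

(** If [a] is eventually below [p], then (a - c - e) / k is eventually below [q]; the slack [e] is
    removed last. *)
Lemma lower_limit_affine p q (k : R) c : (0 < k)%R ->
  (forall e : R, (0 < e)%R -> \forall t \near F, p t <= k%:E * q t + (c + e)%:E) ->
  lower_limit p <= k%:E * lower_limit q + c%:E.
Proof.
move=> k0 pq; apply/lee_addgt0Pr => e e0; rewrite -addeA -EFinD.
apply: ge_ereal_sup => a /= ap.
rewrite -leeBlDr// -lee_pdivrMl//; apply: ereal_sup_ubound => /=.
have {}pq := pq _ e0.
near=> t; rewrite lee_pdivrMl// EFinN leeBlDr//.
by apply: (@le_trans _ _ (p t)); near: t.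
Unshelve. all: by end_near. Qed.

(** For a fixed good [u], p u - e is an eventual lower bound of [p], hence p u is at most the lower
    limit plus e. The matching lower estimate is built into the supremum; infinite limits are
    treated apart. *)
Lemma cvg_lower_limit p :
  (forall e : R, (0 < e)%R ->
    \forall u \near F, \forall v \near F, p u <= p v + e%:E) ->
  p @ F --> lower_limit p.
Proof.
move=> cp.
have {}cp (e : R) : (0 < e)%R -> \forall u \near F, p u <= lower_limit p + e%:E.
  move=> /cp; apply: filterS => u pu; rewrite -leeBlDr//.
  apply: ereal_sup_ubound => /=; move: pu; apply: filterS => v.
  by rewrite EFinN leeBlDr.
have lb (a : \bar R) : a < lower_limit p -> \forall u \near F, a <= p u.
  move=> /ereal_sup_gt[b /= + /ltW ab]; apply: filterS => u; exact: le_trans.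
case: (lower_limit p) cp lb => [r| |] cp lb.
- have fp : \forall u \near F, p u \is a fin_num.
    have := cp 1%R ltr01; have := lb (r - 1)%:E.
    rewrite lte_fin ltrBlDr ltrDl ltr01 => /(_ isT).
    apply: filterS2 => u; case: (p u) => //.
  apply/fine_cvgP; split=> //; apply/cvgrPdist_le => e e0.
  have := cp _ e0; have := lb (r - e)%:E.
  rewrite lte_fin ltrBlDr ltrDl e0 => /(_ isT).
  apply: filterS3 fp => u /=; case: (p u) => //= s _.
  by rewrite -EFinD !lee_fin => ? ?; rewrite ler_norml; lra.
- by apply/cvgeyPge => A; apply: lb; rewrite ltry.
- apply/cvgeNyPle => A; move: (cp 1%R ltr01); apply: filterS => u.
  by rewrite addNye leeNy_eq => /eqP ->; rewrite leNye.
Qed.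

End LowerLimit.

(** * Common properties of liminf and limsup *)

Section MonotoneLimit.
Context {R : realType}.
Local Open Scope ereal_scope.

(* Covers both liminf and limsup, so that the lower and upper pressures are
   treated simultaneously. *)
Definition is_monotone_limit (L : (nat -> \bar R) -> \bar R) :=
  (forall u v, (\forall n \near \oo, u n <= v n) -> L u <= L v) /\
  (forall c : \bar R, L (fun=> c) = c).

Lemma limn_esup_monotone : is_monotone_limit (@limn_esup R).
Proof.
split=> [u v uv|c].
  apply: le_ereal_inf_tmp => _ [A FA <-].
  apply: (@le_trans _ _ (ereal_sup (u @` (A `&` [set n | u n <= v n])))).
    by apply: ereal_inf_lbound; eexists; [exact: filterI FA uv|].
  apply: ge_ereal_sup => _ [n [An /= uvn] <-]; apply: le_trans uvn _.
  by apply: ereal_sup_ubound; exists n.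
have : (fun=> c) @ \oo --> c by exact: cvg_cst.
by move=> /cvg_limn_einf_sup[].
Qed.

Lemma limn_einf_monotone : is_monotone_limit (@limn_einf R).
Proof.
have [mono cst] := limn_esup_monotone; split=> [u v uv|c].
  by rewrite leeN2; apply: mono; apply: filterS uv => n; rewrite leeN2.
by rewrite /limn_einf cst oppeK.
Qed.

End MonotoneLimit.

(** * Compact metric spaces and the filter of fine covers *)

Section CompactMetric.
Context {R : realType} {X : metricType R}.
Context (cptX : compact [set: X]).

(** If the ball of radius r at x lies in a member, so do all balls of radius below r / 2 centred
    within r / 2 of x; compactness makes the radius uniform. *)
Lemma lebesgue_number (W : set (set X)) :
  (forall U, W U -> open U) -> [set: X] `<=` \bigcup_(U in W) U ->
  exists2 e : R, 0 < e & forall x, exists2 U, W U & ball x e `<=` U.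
Proof.
move=> oW cW.
have [|e [e0 He]] := @filter_ex _ (0 : R)^'+ _
    (fun e => 0 < e /\ forall x, exists2 U, W U & ball x e `<=` U); last by exists e.
apply: filterI; first exact: nbhs_right_gt.
have := (compact_near_coveringP _).1 cptX R (0 : R)^'+
  (fun e x => exists2 U, W U & ball x e `<=` U) _ _.
move=> /(_ _) H; near=> e => x; move: x I.
near: e; apply: H => x _.
have [U WU Ux] := cW x I.
have /nbhs_ballP[r /= r0 rU] : nbhs x U by apply: open_nbhs_nbhs; split=> //; exact: oW.
have r20 : 0 < r / 2 by rewrite divr_gt0.
exists (ball x (r / 2), [set e | e < r / 2]); first split => /=.
- exact: nbhsx_ballx.
- exact: nbhs_right_lt.
move=> [y e] /= [xy er]; exists U => // z yz; apply: rU.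
rewrite (splitr r); apply: ball_triangle xy _; exact: le_ball (ltW er) _ yz.
Unshelve. all: by end_near. Qed.

Lemma mdist_bounded : exists D : R, forall x y : X, mdist x y <= D.
Proof.
have [[x0 _]|X0] := pselect ([set: X] !=set0); last first.
  by exists 0 => x; case: X0; exists x.
have [|n Hn] := @filter_ex _ \oo _ (fun n => forall x : X, mdist x0 x < n%:R).
  have := (compact_near_coveringP _).1 cptX nat \oo
    (fun n (x : X) => mdist x0 x < n%:R) _ _.
  move=> /(_ _) H; near=> n => x; move: x I.
  near: n; apply: H => x _.
  exists (ball x 1, [set n | mdist x0 x + 1 < n%:R]); first split => /=.
  - exact: nbhsx_ballx.
  - exact: nbhs_infty_gtr.
  move=> [y n] /= [xy xn]; apply: le_lt_trans xn.
  rewrite ballEmdist/= in xy.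
  by rewrite (le_trans (metric_triangle x0 x y))// lerD2l ltW.
exists (n%:R + n%:R) => x y.
by rewrite (le_trans (metric_triangle x x0 y))// lerD// ltW// metric_sym.
Unshelve. all: by end_near. Qed.

Lemma mdist_le_diam (A : set X) x y : A x -> A y -> mdist x y <= diam A.
Proof.
move=> Ax Ay; have [D HD] := mdist_bounded; apply: ub_le_sup.
  by exists D => _ [a _ [b _ <-]].
by exists x => //; exists y.
Qed.

Lemma diam_le (A : set X) e : 0 <= e ->
  (forall x y, A x -> A y -> mdist x y <= e) -> diam A <= e.
Proof.
(* The empty set has diameter 0, which is where [0 <= e] enters. *)
move=> e0 Ae; have [->|/set0P[x Ax]] := eqVneq A set0.
  rewrite /diam (_ : [set _ | _ in _ & _ in _] = set0) ?sup0//.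
  by apply/seteqP; split=> // z [].
apply: ge_sup; first by exists (mdist x x), x => //; exists x.
by move=> _ [a Aa [b Ab <-]]; exact: Ae.
Qed.

Lemma diam_le_mesh (cU : set (set X)) U : cU U -> diam U <= mesh cU.
Proof.
move=> cUU; have [D HD] := mdist_bounded; apply: ub_le_sup; last by exists U.
exists (Num.max D 0) => _ [V _ <-]; apply: diam_le; first by rewrite le_max lexx orbT.
by move=> x y _ _; rewrite le_max HD.
Qed.

(* [compact_cover] is only available for pointed spaces. *)
Lemma finite_ball_cover (e : R) : 0 < e ->
  exists2 D : set X, finite_set D & forall x, exists2 y, D y & (ball y e)^° x.
Proof.
move=> e0.
(* Finite sets directed by inclusion: the near-covering property along this filter turns one centre
   per point into a single finite set of centres. *)
pose F := filter_from [set D : set X | finite_set D] (fun D => [set E | D `<=` E]).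
have FF : Filter F.
  apply: filter_from_filter; first by exists set0; exact: finite_set0.
  move=> D E fD fE; exists (D `|` E); first by rewrite /= finite_setU.
  by move=> G; rewrite /= subUset => -[].
have := (compact_near_coveringP _).1 cptX (set X) F
  (fun D x => exists2 y, D y & (ball y e)^° x) FF.
case=> [x _|D fD HD]; last by exists D => // x; exact: HD.
exists ((ball x e)^°, [set E | E x]); first split => /=.
- by apply: open_nbhs_nbhs; split; [exact: open_interior|exact: nbhsx_ballx].
- by exists [set x]; [exact: finite_set1|move=> E; exact].
- by move=> [y E] /= [xy Ex]; exists x.
Qed.

Lemma fine_covers_filter : Filter (@fine_covers R X).
Proof.
apply: filter_from_filter; first by exists 1 => /=.
move=> e d /= e0 d0; exists (Num.min e d); first by rewrite /= lt_min e0 d0.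
by move=> cU /= [fU]; rewrite lt_min => /andP[].
Qed.

Lemma fine_covers_proper : [set: X] !=set0 -> ProperFilter (@fine_covers R X).
Proof.
move=> [x0 _]; apply: filter_from_proper; first exact: fine_covers_filter.
move=> e /= e0.
(* Balls of radius e / 4 have diameter at most e / 2, so the mesh stays strictly below e. *)
have e4 : 0 < e / 4 by rewrite divr_gt0.
have [D fD covD] := finite_ball_cover e4.
exists [set (ball x (e / 4))^° | x in D]; split; first split.
- exact: finite_image.
- by move=> _ [x _ <-]; exact: open_interior.
- by move=> x _; have [y yD yx] := covD x; exists ((ball y (e / 4))^°) => //; exists y.
apply: (@le_lt_trans _ _ (e / 2)); last by lra.
apply: ge_sup.
  have [y yD _] := covD x0.
  by exists (diam (ball y (e / 4))^°), (ball y (e / 4))^° => //; exists y.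
move=> _ [_ [x _ <-] <-]; apply: diam_le; first by rewrite divr_ge0// ltW.
move=> a b /interior_subset + /interior_subset; rewrite ballEmdist /= => xa xb.
by have := metric_triangle a x b; rewrite (metric_sym a x); lra.
Qed.

(** A nonempty set of diameter below the Lebesgue number of [W] lies in the ball of that radius
    about any of its points, hence in a member of [W]. *)
Lemma fine_covers_refine (W : set (set X)) : [set: X] !=set0 ->
  (forall U, W U -> open U) -> [set: X] `<=` \bigcup_(U in W) U ->
  \forall cV \near @fine_covers R X, forall V, cV V -> exists2 U, W U & V `<=` U.
Proof.
move=> [x0 _] oW cW; have [e e0 He] := lebesgue_number oW cW.
exists e => //= cV [_ Ve] V VV; have [->|/set0P[x Vx]] := eqVneq V set0.
  by have [U WU _] := cW x0 I; exists U.
have [U WU xU] := He x; exists U => // y Vy; apply: xU.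
rewrite ballEmdist /=.
by rewrite (le_lt_trans (mdist_le_diam Vx Vy))// (le_lt_trans (diam_le_mesh VV)).
Qed.

Definition oscillation_le (phi : X -> R) (cU : set (set X)) (e : R) :=
  forall U, cU U -> forall x y, U x -> U y -> phi x - phi y <= e.

Lemma fine_covers_oscillation (phi : X -> R) (e : R) : [set: X] !=set0 ->
  continuous phi -> 0 < e ->
  \forall cU \near @fine_covers R X, oscillation_le phi cU e.
Proof.
move=> X0 cphi e0.
(* The open sets of small oscillation cover X by continuity, and small oscillation is inherited by
   every refinement. *)
pose W := [set U : set X | open U /\ forall x y, U x -> U y -> phi x - phi y <= e].
have oW U : W U -> open U by case.
have cW : [set: X] `<=` \bigcup_(U in W) U.
  move=> x _; exists (phi @^-1` (ball (phi x) (e / 2))).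
    split.
      apply: open_comp => [y _|]; [exact: cphi|exact: ball_open].
    move=> a b; rewrite /ball/= !ltr_distl; lra.
  by apply: ballxx; rewrite divr_gt0.
have FF := fine_covers_filter.
apply: filterS (fine_covers_refine X0 oW cW) => cU cUW U /cUW[V [_ HV] UV] x y.
by move=> /UV + /UV; exact: HV.
Qed.

Lemma le_sup_norm (phi : X -> R) x : continuous phi -> `|phi x| <= sup_norm phi.
Proof.
move=> cphi; apply: ub_le_sup; last by exists x.
have /compact_bounded[M [_ HM]] : compact (phi @` [set: X]).
  by apply: continuous_compact => //; exact: continuous_subspaceT.
exists (M + 1) => _ [y _ <-]; apply: (HM (M + 1)); first by rewrite ltrDl.
by exists y.
Qed.

End CompactMetric.

(** * Comparison of sums over sets *)

Lemma subset_esum (R : realType) (T : choiceType) (A B : set T) (a : T -> \bar R) :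
  A `<=` B -> (\esum_(i in A) a i <= \esum_(i in B) a i)%E.
Proof.
move=> AB; apply: ge_ereal_sup => _ [D [fD DA] <-]; apply: esum_ge.
by exists D => //; split=> //; exact: subset_trans AB.
Qed.

Lemma esum_image_le (R : realType) (T T' : choiceType) (A : set T) (h : T -> T')
    (a : T -> \bar R) (b : T' -> \bar R) :
  (forall i, A i -> (b (h i) <= a i)%E) ->
  (\esum_(j in h @` A) b j <= \esum_(i in A) a i)%E.
Proof.
move=> ba; have [->|/set0P[i0 Ai0]] := eqVneq A set0.
  by rewrite image_set0 !esum_set0.
(* A section [k] of [h] is injective on the image, so the sum over the image becomes one over a
   subset of [A]; collisions under [h] only drop terms. *)
have /choice[k kP] : forall j, exists i, (h @` A) j -> A i /\ h i = j.
  move=> j; have [[i Ai hi]|nj] := pselect ((h @` A) j); first by exists i.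
  by exists i0.
have kinj : set_inj (h @` A) k.
  move=> i j; rewrite !inE => /kP[_ hi] /kP[_ hj] kij.
  by rewrite -hi -hj kij.
apply: (@le_trans _ _ (\esum_(j in h @` A) a (k j))%E).
  by apply: le_esum => j /kP[Ak {1}<-]; exact: ba.
rewrite -(esum_image _ _ a kinj); apply: subset_esum => _ [j /kP[Ak _] <-] //.
Qed.

(** * Weights of strings and replacement of strings in a cover of Z *)

Section Strings.
Context {R : realType} {X : metricType R}.
Context (f : nat -> X -> X) (Z : set X) (phi : X -> R).
Implicit Types (cU cV : set (set X)) (s t : seq (set X)).

Lemma birkhoff_sumD n k x K : (forall y, `|phi y| <= K) ->
  birkhoff_sum f phi n x <= birkhoff_sum f phi (n + k) x + k%:R * K.
Proof.
move=> phiK; elim: k => [|k IH]; first by rewrite addn0 mul0r addr0.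
rewrite addnS /birkhoff_sum big_ord_recr/= -/(birkhoff_sum _ _ _ _).
have := phiK (comp1 f (n + k) x); rewrite ler_norml => /andP[+ _].
by rewrite -natr1 mulrDl mul1r; move: IH; rewrite /birkhoff_sum; lra.
Qed.

Lemma birkhoff_sum_oscillation cU t g x y : is_string cU t ->
  oscillation_le phi cU g -> string_set f t x -> string_set f t y ->
  birkhoff_sum f phi (size t) y <= birkhoff_sum f phi (size t) x + (size t)%:R * g.
Proof.
move=> tU og tx ty; rewrite -lerBlDl /birkhoff_sum -sumrB.
rewrite mulr_natl -[X in g *+ X]card_ord -sumr_const.
apply: ler_sum => j _.
by apply: (og (nth set0 t j)); [apply/tU/mem_nth|exact: ty|exact: tx].
Qed.

(** Fix x in the smaller set. Moving from y to x along [t] costs at most [g] per letter, and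
    extending the Birkhoff sum at x to the length of [s] costs at most K per added term; the result
    is below the supremum for [s]. *)
Lemma string_weight_le cU s t alpha alpha' K g :
  (forall y, `|phi y| <= K) -> oscillation_le phi cU g -> is_string cU t ->
  (size t <= size s)%N -> string_set f s `<=` string_set f t ->
  string_set f s !=set0 ->
  alpha * (size s)%:R + ((size s)%:R - (size t)%:R) * K + (size t)%:R * g
    <= alpha' * (size t)%:R ->
  (string_weight f phi alpha' t <= string_weight f phi alpha s)%E.
Proof.
move=> phiK og tU ts st [x sx] le_exp; rewrite /string_weight lee_expeR.
rewrite -leeBrDl ?fin_numN// -EFinN opprK.
apply: ge_ereal_sup => _ [y ty <-].
apply: (@le_trans _ _ ((- (alpha * (size s)%:R))%:E
    + (birkhoff_sum f phi (size s) x)%:E + (alpha' * (size t)%:R)%:E)%E).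
  rewrite -!EFinD lee_fin.
  have := birkhoff_sum_oscillation tU og (st _ sx) ty.
  have := birkhoff_sumD (size t) (size s - size t) x phiK.
  rewrite subnKC// natrB//; lra.
by rewrite leeD2r// leeD2l//; apply: ereal_sup_ubound; exists x.
Qed.

Lemma M_ge0 alpha cU N theta : (0 <= M f Z alpha phi cU N theta)%E.
Proof.
apply: le_ereal_inf_tmp => _ [G _ <-]; apply: esum_ge0 => s _; exact: expeR_ge0.
Qed.

(* Strings with empty [string_set] must be discarded: their weight is 0,
   whereas the weight of their replacement need not be. *)
Lemma M_le_replace cU cV N N' theta theta' alpha alpha' :
  (forall s, is_string cV s -> admissible_length theta N (size s) ->
    string_set f s !=set0 ->
    exists t, [/\ is_string cU t, admissible_length theta' N' (size t),
      string_set f s `<=` string_set f t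
      & (string_weight f phi alpha' t <= string_weight f phi alpha s)%E]) ->
  (M f Z alpha' phi cU N' theta' <= M f Z alpha phi cV N theta)%E.
Proof.
move=> repl; apply: le_ereal_inf_tmp => _ [G [cG GV ZG] <-].
pose G0 := G `&` [set s | string_set f s !=set0].
have /choice[h hP] : forall s, exists t, G0 s ->
    [/\ is_string cU t, admissible_length theta' N' (size t),
      string_set f s `<=` string_set f t
      & (string_weight f phi alpha' t <= string_weight f phi alpha s)%E].
  move=> s; have [[Gs s0]|ns] := pselect (G0 s); last by exists [::].
  by have [sV sN] := GV _ Gs; have [t ?] := repl _ sV sN s0; exists t.
apply: (@le_trans _ _ (\esum_(t in h @` G0) string_weight f phi alpha' t)%E).
  apply: ereal_inf_lbound; exists (h @` G0) => //; split.
  - apply: (card_le_trans (card_image_le _ _)).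
    by apply: sub_countable cG; apply: subset_card_le; exact: subIsetl.
  - by move=> _ [s /hP[? ? _ _] <-].
  - move=> x /ZG[s Gs sx]; have G0s : G0 s by split=> //; exists x.
    by have [_ _ st _] := hP _ G0s; exists (h s); [exists s|exact: st].
apply: (@le_trans _ _ (\esum_(s in G0) string_weight f phi alpha s)%E).
  by apply: esum_image_le => s /hP[].
by apply: subset_esum; exact: subIsetl.
Qed.

(** One string whose set contains a point of Z already has weight at least 1. This forces a > -K
    whenever the limit at exponent [a] vanishes. *)
Lemma M_ge1 cU N theta alpha K : Z !=set0 -> (forall y, `|phi y| <= K) ->
  alpha <= - K -> (1 <= M f Z alpha phi cU N theta)%E.
Proof.
move=> [z Zz] phiK aK; apply: le_ereal_inf_tmp => _ [G [_ _ ZG] <-].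
have [s Gs sz] := ZG z Zz.
apply: (@le_trans _ _ (string_weight f phi alpha s)).
  rewrite -(@expeR0 R) lee_expeR.
  apply: (@le_trans _ _ ((- (alpha * (size s)%:R))%:E
    + (birkhoff_sum f phi (size s) z)%:E)%E).
    have := birkhoff_sumD 0 (size s) z phiK.
    rewrite {1}/birkhoff_sum big_ord0 add0n -EFinD lee_fin => H.
    have : (size s)%:R * alpha <= (size s)%:R * - K by rewrite ler_wpM2l.
    by lra.
  by rewrite leeD2l//; apply: ereal_sup_ubound; exists z.
have w0 t : (0 <= string_weight f phi alpha t)%E by exact: expeR_ge0.
by rewrite -(esum_set1 (w0 s)); apply: subset_esum => _ ->.
Qed.

End Strings.

(** * Comparison of pressures, first for covers and then in the limit *)

Section Pressures.
Context {R : realType} {X : metricType R}.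
Context (L : (nat -> \bar R) -> \bar R) (LM : is_monotone_limit L).
Context (f : nat -> X -> X) (Z : set X) (phi : X -> R).
Implicit Types (cU cV : set (set X)) (theta : R).

Definition pressure_cover cU theta : \bar R :=
  ereal_inf [set a%:E | a in [set a : R |
    L (fun N => M f Z a phi cU N theta) = 0%E]].

Definition pressure theta : \bar R :=
  lim (pressure_cover cU theta @[cU --> fine_covers]).

(** Each exponent [a] with vanishing limit for [cV] yields k * a + c + e with vanishing limit for
    [cU], as M is nonnegative; then pass to infima. *)
Lemma pressure_cover_le cU cV theta theta' k c : 0 < k ->
  (forall a, L (fun N => M f Z a phi cV N theta) = 0%E ->
    forall e, 0 < e -> \forall N \near \oo,
      (M f Z (k * a + c + e)%R phi cU N theta' <= M f Z a phi cV N theta)%E) ->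
  (pressure_cover cU theta' <= k%:E * pressure_cover cV theta + c%:E)%E.
Proof.
move=> k0 HM; apply/lee_addgt0Pr => e e0; rewrite -addeA -EFinD.
rewrite -leeBlDr// -lee_pdivrMl//; apply: le_ereal_inf_tmp => _ [a La <-].
rewrite lee_pdivrMl// leeBlDr// -EFinM -EFinD.
apply: ereal_inf_lbound; exists (k * a + (c + e)) => //=.
apply/eqP; rewrite eq_le; apply/andP; split.
  by rewrite -La addrA; apply: LM.1; exact: HM.
by rewrite -(LM.2 0%E); apply: LM.1; apply: nearW => N; exact: M_ge0.
Qed.

Lemma pressure_cover_le_theta cU theta theta' : 0 < theta -> theta <= theta' ->
  (pressure_cover cU theta <= pressure_cover cU theta')%E.
Proof.
move=> t0 tt'; have t'0 := lt_le_trans t0 tt'.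
have := @pressure_cover_le cU cU theta' theta 1 0 ltr01.
rewrite mul1e adde0; apply => a _ e e0; apply: nearW => N.
apply: M_le_replace => s sU [Ns sN] s0; exists s; split=> //.
  split=> //; right; case: sN => [t0'|]; first by rewrite t0' ltxx in t'0.
  by move=> /lt_le_trans; apply; rewrite lerD2r ler_wpM2l// lef_pV2.
rewrite /string_weight lee_expeR leeD2r// lee_fin lerN2 ler_wpM2r//; lra.
Qed.

(** Each letter of a string over [cV] is replaced by a member of [cU] containing it, which keeps the
    length and costs [g] per letter. *)
Lemma pressure_cover_refine cU cV theta g K : (forall y, `|phi y| <= K) ->
  oscillation_le phi cU g -> (forall V, cV V -> exists2 U, cU U & V `<=` U) ->
  (pressure_cover cU theta <= pressure_cover cV theta + g%:E)%E.
Proof.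
move=> phiK og VU.
have /choice[h hP] : forall V, exists U, cV V -> cU U /\ V `<=` U.
  move=> V; have [/VU[U]|nV] := pselect (cV V); last by exists V.
  by exists U.
have := @pressure_cover_le cU cV theta theta 1 g ltr01.
rewrite mul1e; apply => a _ e e0; apply: nearW => N.
apply: M_le_replace => s sV sN s0; exists (map h s).
have hU : is_string cU (map h s) by move=> _ /mapP[V /sV /hP[? _] ->].
have sh : string_set f s `<=` string_set f (map h s).
  move=> x sx j; rewrite size_map => js; rewrite (nth_map set0)//.
  by have /sV/hP[_] := mem_nth set0 js; apply; exact: sx.
split=> //; first by rewrite size_map.
apply: (string_weight_le phiK og hU _ sh s0); rewrite size_map//.
have : 0 <= e * (size s)%:R by rewrite mulr_ge0// ltW.
lra.
Qed.

(* Strings longer than [m = ceil (N / theta')] are truncated to length [m]; the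
   ratio of lengths is then at most [theta' / theta + theta' / N]. *)
Lemma pressure_cover_truncate cU theta theta' g K : Z !=set0 ->
  (forall y, `|phi y| <= K) -> oscillation_le phi cU g ->
  0 < theta -> theta <= theta' -> theta' <= 1 ->
  (pressure_cover cU theta' <= (theta' / theta)%:E * pressure_cover cU theta
    + ((theta' / theta - 1) * K + g)%:E)%E.
Proof.
move=> Z0 phiK og t0 tt' t'1; have t'0 := lt_le_trans t0 tt'.
set k := theta' / theta; have k1 : 1 <= k by rewrite ler_pdivlMr// mul1r.
apply: pressure_cover_le => [|a La e e0]; first exact: lt_le_trans k1.
have b0 : 0 <= a + K.
  rewrite leNgt; apply/negP => b0.
  have : (1 <= L (fun N => M f Z a phi cU N theta))%E.
    rewrite -[leLHS]LM.2; apply: LM.1; apply: nearW => N.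
    by apply: (M_ge1 f cU N theta Z0 phiK); lra.
  by rewrite La lee_fin ler10.
near=> N.
(* This lets N * e absorb the extra a + K coming from the + 1 in the bound N / theta + 1 on
   lengths. *)
have Nbig : (a + K) / e <= N%:R by near: N; exact: nbhs_infty_ger.
have N0 : 0 <= N%:R / theta' by rewrite divr_ge0// ltW.
pose m := `|Num.ceil (N%:R / theta')|%N.
have mE : m%:R = (Num.ceil (N%:R / theta'))%:~R :> R.
  by rewrite natr_absz ger0_norm// -(ler_int R) (le_trans N0)// ceil_ge.
have mge : N%:R / theta' <= m%:R by rewrite mE ceil_ge.
have mlt : m%:R < N%:R / theta' + 1.
  by rewrite mE -ltrBlDr -[X in _ - X]/(1%:~R) -intrB ceilB1_lt.
have Nm : (N <= m)%N.
  rewrite -(ler_nat R); apply: le_trans mge.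
  by rewrite ler_pdivlMr// ler_piMr.
apply: M_le_replace => s sU [Ns sN] s0; exists (take m s).
have tU : is_string cU (take m s) by move=> U /mem_take /sU.
have szt : size (take m s) = minn m (size s) by exact: size_take_min.
have st : string_set f s `<=` string_set f (take m s).
  move=> x sx j; rewrite szt leq_min => /andP[jm js].
  by rewrite nth_take//; exact: sx.
split=> //.
  rewrite szt; split; first by rewrite leq_min Nm.
  by right; apply: le_lt_trans mlt; rewrite ler_nat geq_minl.
apply: (string_weight_le phiK og tU _ st s0); rewrite szt ?geq_minr//.
set n : R := (size s)%:R; set n' : R := (minn m (size s))%:R.
(* The hypothesis of [string_weight_le] at the new exponent, after the terms in [g] cancel and K is
   grouped with [a]. *)
suff : n * (a + K) <= n' * (k * (a + K) + e) by lra.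
(* Strings shorter than [m] are unchanged by truncation, and k >= 1 suffices for them. *)
have [ms|sm] := leqP m (size s); last first.
  rewrite /n' /n (minn_idPr (ltnW sm)) ler_wpM2l//.
  by have := ler_wpM2r b0 k1; lra.
rewrite /n' (minn_idPl ms).
have sN' : n <= N%:R / theta + 1 by case: sN => [t00|/ltW//]; rewrite t00 ltxx in t0.
apply: (@le_trans _ _ ((N%:R / theta + 1) * (a + K))); first by rewrite ler_wpM2r.
apply: (@le_trans _ _ (N%:R / theta' * (k * (a + K)) + N%:R * e)).
  have -> : N%:R / theta' * (k * (a + K)) = N%:R / theta * (a + K).
    by rewrite /k; field; rewrite !gt_eqF.
  by rewrite mulrDl mul1r lerD2l -ler_pdivrMr.
rewrite [leRHS]mulrDr lerD//; first by rewrite ler_wpM2r// mulr_ge0//; lra.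
by rewrite ler_wpM2r ?ler_nat// ltW.
Unshelve. all: by end_near. Qed.

Context (cptX : compact [set: X]) (cphi : continuous phi) (Z0 : Z !=set0).

Let X0 : [set: X] !=set0. Proof. by case: Z0 => z _; exists z. Qed.

(** Once [cU] has oscillation at most e, every sufficiently fine [cV] refines it, so
    [pressure_cover_refine] gives the hypothesis of [cvg_lower_limit]. *)
Lemma pressureE theta :
  pressure theta = lower_limit fine_covers (pressure_cover ^~ theta).
Proof.
have FF := fine_covers_proper cptX X0.
apply: cvg_lim => //; apply: cvg_lower_limit => e e0.
have [d /= d0 Hd] : (\forall cU \near @fine_covers R X,
    oscillation_le phi cU e /\ finite_open_cover cU).
  apply: filterI; first exact: fine_covers_oscillation.
  by exists 1 => //= cU [].
exists d => //= cU /Hd[og [_ oU cU_cov]].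
apply: filterS (fine_covers_refine cptX X0 oU cU_cov) => cV.
exact: pressure_cover_refine (fun y => le_sup_norm cptX y cphi) og.
Qed.

Lemma pressure_le theta theta' : 0 < theta -> theta <= theta' ->
  (pressure theta <= pressure theta')%E.
Proof.
move=> t0 tt'; have FF := fine_covers_proper cptX X0; rewrite !pressureE.
by apply: lower_limit_le; apply: nearW => cU; exact: pressure_cover_le_theta.
Qed.

Lemma pressure_le_ratio theta theta' :
  0 < theta -> theta <= theta' -> theta' <= 1 ->
  (pressure theta' <= (theta' / theta)%:E * pressure theta
    + ((theta' / theta - 1) * sup_norm phi)%:E)%E.
Proof.
move=> t0 tt' t'1; have FF := fine_covers_proper cptX X0; rewrite !pressureE.
apply: lower_limit_affine => [|e e0]; first by rewrite divr_gt0// (lt_le_trans t0).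
apply: filterS (fine_covers_oscillation cptX X0 cphi e0) => cU og.
exact: pressure_cover_truncate (fun y => le_sup_norm cptX y cphi) og t0 tt' t'1.
Qed.

End Pressures.

Lemma sup_norm_cst0 (R : realType) (X : metricType R) :
  [set: X] !=set0 -> sup_norm (cst 0 : X -> R) = 0.
Proof.
move=> [x _]; rewrite /sup_norm (_ : [set _ | _ in _] = [set 0]) ?sup1//.
apply/seteqP; split=> [_ [y _ <-]|_ ->]; first exact: normr0.
by exists x => //; exact: normr0.
Qed.

Theorem proposition2p6 (R : realType) (X : metricType R)
  (cptX : compact [set: X])
  (f : nat -> X -> X) (cf : forall i : nat, (0 < i)%N -> continuous (f i))
  (varphi : X -> R) (cvarphi : continuous varphi)
  (Z : set X) (Z0 : Z !=set0)
  (theta phi : R) (theta_gt0 : 0 < theta) (theta_phi : theta < phi)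
  (phi_le1 : phi <= 1) :
  [/\ (upper_pressure f Z varphi theta <= upper_pressure f Z varphi phi)%E
      /\ (upper_pressure f Z varphi phi <=
          (phi / theta)%:E * upper_pressure f Z varphi theta
          + ((phi / theta - 1) * sup_norm varphi)%:E)%E,
      (lower_pressure f Z varphi theta <= lower_pressure f Z varphi phi)%E
      /\ (lower_pressure f Z varphi phi <=
          (phi / theta)%:E * lower_pressure f Z varphi theta
          + ((phi / theta - 1) * sup_norm varphi)%:E)%E,
      (upper_entropy f Z theta <= upper_entropy f Z phi)%E
      /\ (upper_entropy f Z phi <= (phi / theta)%:E * upper_entropy f Z theta)%E
    & (lower_entropy f Z theta <= lower_entropy f Z phi)%E
      /\ (lower_entropy f Z phi <= (phi / theta)%:E * lower_entropy f Z theta)%E].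
Proof.
have main L (LM : is_monotone_limit L) psi (cpsi : continuous psi) :
    (pressure L f Z psi theta <= pressure L f Z psi phi)%E
    /\ (pressure L f Z psi phi <= (phi / theta)%:E * pressure L f Z psi theta
        + ((phi / theta - 1) * sup_norm psi)%:E)%E.
  by split; [apply: pressure_le|apply: pressure_le_ratio] => //; exact: ltW.
have main0 L (LM : is_monotone_limit L) :
    (pressure L f Z (cst 0%R) theta <= pressure L f Z (cst 0%R) phi)%E
    /\ (pressure L f Z (cst 0%R) phi
        <= (phi / theta)%:E * pressure L f Z (cst 0%R) theta)%E.
  have [] := main L LM (cst 0) (fun=> cvg_cst _).
  rewrite sup_norm_cst0 ?mulr0 ?adde0//.
  by case: Z0 => z _; exists z.
split.
(* For these two choices of [L], [pressure L] unfolds to the upper and lower pressures. *)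
- exact: main (@limn_esup_monotone R) _ cvarphi.
- exact: main (@limn_einf_monotone R) _ cvarphi.
- exact: main0 (@limn_esup_monotone R).
- exact: main0 (@limn_einf_monotone R).
Qed.
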